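(* Fix $0<\vartheta<1$ and $\varepsilon_{\mathrm{CKN}}>0$. There is a constant $\tau_{\mathrm{CKN}}>0$, depending only on $\vartheta$ and $\varepsilon_{\mathrm{CKN}}$, such that the following holds. Let $D_k$ be a scale-$k$ package with normalized pressure-admissible fields $(u_k,p_k)$ on $Q_1$ and baseline audit distance $\delta_k\ge0$, and assume $$\delta_k^{\mathrm{CKN}}\le C_{\mathrm{CKN/aud}}\,\delta_k+\Delta_k^{\mathrm{gauge}}.$$ If $\Phi_k(\vartheta)\ge\varepsilon_{\mathrm{CKN}}$, then $$C_{\mathrm{CKN/aud}}\,\delta_k+\Delta_k^{\mathrm{gauge}}>\tau_{\mathrm{CKN}}.$$ In particular, if $\Delta_k^{\mathrm{gauge}}\le\frac12\tau_{\mathrm{CKN}}$, then $$\delta_k\ge\delta_*,\qquad\delta_*:=\frac{\tau_{\mathrm{CKN}}}{2C_{\mathrm{CKN/aud}}}.$$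
   Context: $Q_1=B_1\times(-1,0)\subset\mathbb R^3\times\mathbb R$, $Q_\vartheta=B_\vartheta\times(-\vartheta^2,0)$, $(f)_{B_\vartheta}=|B_\vartheta|^{-1}\int_{B_\vartheta}f$. Fields satisfy $u\in L^3(Q_1)^3$, $p\in L^{3/2}(Q_1)$. For a pair $(u,p)$ put $$\Phi(\vartheta)=\int_{Q_\vartheta}|u|^3+\int_{-\vartheta^2}^0\int_{B_\vartheta}|p-(p)_{B_\vartheta}(s)|^{3/2}\,dy\,ds;$$ $\Phi_k$ is this for $(u_k,p_k)$ and $\Phi_\zeta$ for $(u_\zeta,p_\zeta)$. The CKN-compatible clean class $\Gamma_{\Lambda,k}^{\mathrm{CKN}}$ is a selected class of packages $\zeta$ with associated normalized fields $(u_\zeta,p_\zeta)$ on $Q_1$ (pressure modulo time-dependent constants) satisfying $\Phi_\zeta(\vartheta)\le\varepsilon_{\mathrm{CKN}}/4$. The CKN-compatible distance is $$\delta_k^{\mathrm{CKN}}=\inf_{\zeta\in\Gamma_{\Lambda,k}^{\mathrm{CKN}}}\Bigl[\|u_k-u_\zeta\|_{L^3(Q_\vartheta)}+\inf_{a=a(s)}\|p_k-p_\zeta-a(s)\|_{L^{3/2}(Q_\vartheta)}\Bigr],$$ the inner infimum over functions of time. $\delta_k$ is the given audit baseline distance of $D_k$ to its gauge class, $\Delta_k^{\mathrm{gauge}}\ge0$ a given gauge comparison error, $C_{\mathrm{CKN/aud}}>0$ a given constant. *)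

(* Defs.v *)
From HB Require Import structures.
From mathcomp Require Import all_boot all_order all_algebra.
From mathcomp Require Import all_classical all_reals all_analysis.

Set Implicit Arguments.
Unset Strict Implicit.
Unset Printing Implicit Defensive.
Import Order.TTheory GRing.Theory Num.Theory.
Import numFieldNormedType.Exports.

Local Open Scope classical_set_scope.
Local Open Scope ring_scope.

(* [measurableTypeR R] is R with its Borel sigma-algebra, as the carrier of
   [lebesgue_measure]. The library norm on these products is the sup norm, so
   the Euclidean norm is introduced separately as [enorm]. *)
Notation time R := (measurableTypeR R).
Notation space R :=
  (measurableTypeR R * measurableTypeR R * measurableTypeR R)%type.
Notation spacetime R := (space R * time R)%type.

Definition enorm (R : realType) (x : space R) : R :=
  Num.sqrt ((x.1.1 : R) ^+ 2 + (x.1.2 : R) ^+ 2 + (x.2 : R) ^+ 2).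

Definition leb3 (R : realType) : {measure set (space R) -> \bar R} :=
  (@lebesgue_measure R \x @lebesgue_measure R \x @lebesgue_measure R)%E.

Definition leb4 (R : realType) : {measure set (spacetime R) -> \bar R} :=
  (leb3 R \x @lebesgue_measure R)%E.

Definition Ball (R : realType) (r : R) : set (space R) := [set y | enorm y < r].

Definition Itime (R : realType) (r : R) : set (time R) := `]- r ^+ 2, 0[.

Definition Cyl (R : realType) (r : R) : set (spacetime R) := Ball r `*` Itime r.

Definition LnormOn (R : realType) (q : R) (D : set (spacetime R))
    (f : spacetime R -> R) : \bar R :=
  ('N[leb4 R]_(q%:E) [EFin \o (f \_ D)])%E.

(* A pair (u, p) with u in L^3(Q_1)^3 and p in L^{3/2}(Q_1), given by
   representatives; only the values on Q_1 matter. *)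
Record nfields (R : realType) := NFields {
  vel : spacetime R -> space R ;
  pre : spacetime R -> R ;
  vel_meas : measurable_fun (Cyl 1) vel ;
  pre_meas : measurable_fun (Cyl 1) pre ;
  vel_L3 : (LnormOn 3 (Cyl 1) (fun z => enorm (vel z)) < +oo)%E ;
  pre_L32 : (LnormOn (3 / 2) (Cyl 1) pre < +oo)%E }.

(* When r <= 1, the slice p(., s) is integrable on B_r for almost every s in
   ]-1, 0[; on the exceptional null set the integral is the library's default. *)
Definition mean (R : realType) (p : spacetime R -> R) (r s : R) : R :=
  (fine (leb3 R (Ball r)))^-1 * \int[leb3 R]_(y in Ball r) p (y, s).

Definition Phi (R : realType) (w : nfields R) (r : R) : \bar R :=
  (\int[leb4 R]_(z in Cyl r) (enorm (vel w z) ^+ 3)%:E +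
   \int[@lebesgue_measure R]_(s in Itime r)
     \int[leb3 R]_(y in Ball r)
       (`|pre w (y, s) - mean (pre w) r s| `^ (3 / 2))%:E)%E.

(* Distance of the pressures modulo functions a = a(s) of time; a is measurable
   because the library integral of a non-measurable function is not meaningful,
   and a with infinite L^{3/2}-distance does not affect the infimum. *)
Definition pdist (R : realType) (r : R) (w w' : nfields R) : \bar R :=
  ereal_inf [set LnormOn (3 / 2) (Cyl r)
                   (fun z => (pre w z - pre w' z - a z.2)%R)
            | a in [set a : time R -> R | measurable_fun (Itime r) a]].

(* The infimum is taken in the extended reals: it is +oo on an empty class. *)
Definition deltaCKN (R : realType) (T : Type) (fields : T -> nfields R)
    (r : R) (G : set T) (w : nfields R) : \bar R :=
  ereal_inf [set (LnormOn 3 (Cyl r)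
                    (fun z => enorm (vel w z - vel (fields zeta) z)%R) +
                  pdist r w (fields zeta))%E
            | zeta in G].

(* Main.v *)
(* Write w = (u, p). On the cylinder, |u|^3 <= 2 |u'|^3 + C |u - u'|^3, and
   likewise |p - (p)|^(3/2) is controlled on almost every time slice by
   2 |p' - (p')|^(3/2) plus a constant times |g|^(3/2) and |(g)|^(3/2), where
   g = p - p' - a(s); subtracting the mean removes a(s), and Jensen absorbs (g)
   into the integral of |g|^(3/2). Hence a clean competitor at distance less
   than t <= 1 gives Phi(w) <= 2 Phi(w') + K t <= eps / 2 + K t, which
   contradicts Phi(w) >= eps when t is small. *)
Require Import Defs.
From HB Require Import structures.
From mathcomp Require Import all_boot all_order all_algebra.
From mathcomp Require Import all_classical all_reals all_analysis.
From mathcomp Require Import measurable_realfun ring lra.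

Set Implicit Arguments.
Unset Strict Implicit.
Unset Printing Implicit Defensive.
Import Order.TTheory GRing.Theory Num.Theory.
Import numFieldNormedType.Exports.

Local Open Scope classical_set_scope.
Local Open Scope ring_scope.

(** * Power inequalities and comparison of integrals *)

Lemma powRD_le (R : realType) (q a b : R) : 0 <= q <= 3 -> 0 <= a -> 0 <= b ->
  (a + b) `^ q <= 2 * a `^ q + 5 ^+ 3 * b `^ q.
Proof.
move=> /andP[q0 q3] a0 b0.
have cst_le (c n : R) : 1 <= c -> c ^+ 3 <= n -> c `^ q <= n.
  move=> c1; apply: le_trans.
  by rewrite -powR_mulrn ?(le_trans _ c1)// ler_powR.
have aq := powR_ge0 a q; have bq := powR_ge0 b q.
have [ba|ab] := leP b (a / 4).
- apply: (@le_trans _ _ ((5 / 4 * a) `^ q)).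
    by apply: ge0_ler_powR; rewrite ?nnegrE; lra.
  rewrite powRM//.
  have h : (5 / 4 : R) `^ q <= 2 by apply: cst_le; lra.
  by have := ler_wpM2r aq h; lra.
- apply: (@le_trans _ _ ((5 * b) `^ q)).
    by apply: ge0_ler_powR; rewrite ?nnegrE; lra.
  rewrite powRM//.
  have h : (5 : R) `^ q <= 5 ^+ 3 by apply: cst_le; lra.
  by have := ler_wpM2r bq h; lra.
Qed.

(** The pointwise bound is assumed only almost everywhere because it will be applied in time, where
    the slices of the pressures are integrable for almost every [s]. *)
Lemma ae_integral_le_lincomb d (T : measurableType d) (R : realType)
    (m : {measure set T -> \bar R}) (D : set T) (a b : R)
    (F G H : T -> \bar R) :
  measurable D -> 0 <= a -> 0 <= b ->
  measurable_fun D F -> measurable_fun D G -> measurable_fun D H ->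
  (forall x, D x -> 0 <= F x)%E -> (forall x, D x -> 0 <= G x)%E ->
  (forall x, D x -> 0 <= H x)%E ->
  {ae m, forall x, D x -> (F x <= a%:E * G x + b%:E * H x)%E} ->
  (\int[m]_(x in D) F x <=
   a%:E * \int[m]_(x in D) G x + b%:E * \int[m]_(x in D) H x)%E.
Proof.
move=> mD a0 b0 mF mG mH F0 G0 H0 FGH.
have aG0 x : D x -> (0 <= a%:E * G x)%E.
  by move=> Dx; apply: mule_ge0; [rewrite lee_fin|exact: G0].
have bH0 x : D x -> (0 <= b%:E * H x)%E.
  by move=> Dx; apply: mule_ge0; [rewrite lee_fin|exact: H0].
have maG : measurable_fun D (fun x => a%:E * G x)%E by exact: measurable_funeM.
have mbH : measurable_fun D (fun x => b%:E * H x)%E by exact: measurable_funeM.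
rewrite -(ge0_integralZl m mD mG G0) ?lee_fin//.
rewrite -(ge0_integralZl m mD mH H0) ?lee_fin//.
rewrite -(ge0_integralD m mD aG0 maG bH0 mbH).
apply: (ae_ge0_le_integral mD F0 mF _ _ FGH).
  by move=> x Dx; apply: adde_ge0; [exact: aG0|exact: bH0].
exact: emeasurable_funD.
Qed.

Lemma integral_le_lincomb d (T : measurableType d) (R : realType)
    (m : {measure set T -> \bar R}) (D : set T) (a b : R) (f g h : T -> R) :
  measurable D -> 0 <= a -> 0 <= b ->
  measurable_fun D f -> measurable_fun D g -> measurable_fun D h ->
  (forall x, 0 <= f x) -> (forall x, 0 <= g x) -> (forall x, 0 <= h x) ->
  (forall x, f x <= a * g x + b * h x) ->
  (\int[m]_(x in D) (f x)%:E <=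
   a%:E * \int[m]_(x in D) (g x)%:E + b%:E * \int[m]_(x in D) (h x)%:E)%E.
Proof.
move=> mD a0 b0 mf mg mh f0 g0 h0 fgh.
apply: (ae_integral_le_lincomb mD a0 b0).
- exact/measurable_EFinP.
- exact/measurable_EFinP.
- exact/measurable_EFinP.
- by move=> x _; rewrite lee_fin.
- by move=> x _; rewrite lee_fin.
- by move=> x _; rewrite lee_fin.
- by apply/nearW => x _; rewrite -!EFinM -EFinD lee_fin.
Qed.

Lemma measurable_fun_normr_powR d (T : measurableType d) (R : realType)
    (D : set T) (q : R) (h : T -> R) :
  measurable_fun D h -> measurable_fun D (fun x => `|h x| `^ q).
Proof.
move=> mh; apply: (@measurableT_comp _ _ _ _ _ _ (@powR R ^~ q)).
  exact: measurable_powR.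
exact: measurableT_comp.
Qed.

(** * Averages over a set of finite measure *)

Section average.
Context d (T : measurableType d) (R : realType).
Variables (m : {measure set T -> \bar R}) (B : set T).
Hypotheses (mB : measurable B) (mBoo : (m B < +oo)%E).

(** With [leb3 R], [Ball r] and the slice [p (., s)], this is [mean p r s] by conversion, so the
    results below apply directly to the pressure. *)
Definition avg (f : T -> R) : R := (fine (m B))^-1 * \int[m]_(y in B) f y.

Lemma finite_set_integrable_cst (c : R) : m.-integrable B (EFin \o cst c).
Proof.
apply/integrableP; split; first exact/measurable_EFinP.
under eq_integral do rewrite /=.
by rewrite integral_cst// lte_mul_pinfty// ?lee_fin.
Qed.

Lemma avgB (f g : T -> R) :
  m.-integrable B (EFin \o f) -> m.-integrable B (EFin \o g) ->
  avg (fun y => f y - g y) = avg f - avg g.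
Proof. by move=> fi gi; rewrite /avg RintegralB// mulrBr. Qed.

Lemma avg_cst (c : R) : m B != 0%E -> avg (cst c) = c.
Proof.
move=> B0; rewrite /avg Rintegral_cst// mulrCA mulVf ?mulr1// fine_eq0//.
by rewrite ge0_fin_numE.
Qed.

(* A weak Jensen inequality: with [M = |avg g|], integrate
   [|g| <= M / 2 + (M / 2) ^ (1 - q) |g| ^ q] and use [M m(B) <= \int_B |g|]. *)
Lemma powR_avg_le (q : R) (g : T -> R) : 1 <= q ->
  m.-integrable B (EFin \o g) ->
  ((`|avg g| `^ q)%:E * m B <=
   (2 `^ q)%:E * \int[m]_(y in B) (`|g y| `^ q)%:E)%E.
Proof.
move=> q1 gi.
have q0 : q != 0 by rewrite gt_eqF//; lra.
have mg : measurable_fun B g by apply/measurable_EFinP; exact: measurable_int gi.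
have mgq : measurable_fun B (fun y => `|g y| `^ q).
  exact: measurable_fun_normr_powR.
set J := (\int[m]_(y in B) _)%E.
have J0 : (0 <= J)%E by apply: integral_ge0 => y _; rewrite lee_fin powR_ge0.
have [->|M0] := eqVneq (avg g) 0.
  by rewrite normr0 powR0// mul0e mule_ge0// lee_fin powR_ge0.
(* If [J] is infinite, so is the right-hand side; otherwise the inequality can be moved to real
   numbers. *)
have [Joo|] := leP +oo%E J.
  have -> : J = +oo%E by apply/eqP; rewrite -leye_eq.
  by rewrite gt0_muley ?leey// lte_fin powR_gt0.
move=> Joo.
have Mp : 0 < `|avg g| by rewrite normr_gt0.
set M := `|avg g| in Mp *.
have bfin : m B \is a fin_num by rewrite ge0_fin_numE.
have Jfin : J \is a fin_num by rewrite ge0_fin_numE.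
have pt y : `|g y| <= M / 2 + (M / 2) `^ (1 - q) * `|g y| `^ q.
  (* Above [M / 2], write |g| as |g|^(1 - q) |g|^q; since 1 - q <= 0, the first factor is at most (M
     / 2)^(1 - q). *)
  have [h|h] := leP `|g y| (M / 2).
    by rewrite (le_trans h)// lerDl mulr_ge0// powR_ge0.
  have gp : 0 < `|g y| by rewrite (le_lt_trans _ h)//; lra.
  have e : `|g y| = `|g y| `^ (1 - q) * `|g y| `^ q.
    rewrite -powRD; last by rewrite (gt_eqF gp) implybT.
    by rewrite addrNK powRr1// ltW.
  rewrite {1}e; apply: ler_wpDl; first lra.
  rewrite ler_wpM2r ?powR_ge0//.
  rewrite -[1 - q]opprB !powRN lef_pV2 ?posrE ?powR_gt0//; last lra.
  by apply: ge0_ler_powR; rewrite ?nnegrE; lra.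
have intle : (\int[m]_(y in B) (`|g y|)%:E <=
    (M / 2)%:E * m B + ((M / 2) `^ (1 - q))%:E * J)%E.
  rewrite -[m B]mul1e -integral_cst//.
  apply: integral_le_lincomb => //.
  - lra.
  - by rewrite powR_ge0.
  - exact: measurableT_comp.
  - by move=> y; rewrite mulr1.
have Mle : (M%:E * m B <= \int[m]_(y in B) (`|g y|)%:E)%E.
  have [B0|B0] := eqVneq (m B) 0%E.
    by rewrite B0 mule0 integral_ge0.
  have fb : 0 < fine (m B).
    by rewrite fine_gt0// lt0e B0/= measure_ge0 ltey_eq bfin.
  rewrite -[m B]fineK// -EFinM /M /avg normrM normfV (gtr0_norm fb).
  rewrite mulrAC mulVf ?gt_eqF// mul1r EFin_normr_Rintegral//.
  apply: le_abse_integral => //; exact/measurable_EFinP.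
have := le_trans Mle intle.
rewrite -[m B]fineK// -[J]fineK// -!EFinM -EFinD !lee_fin => h.
(* Half of [M * m B] is absorbed on the left, leaving t m(B) <= t^(1 - q) J. Multiplying by t^(q -
   1) gives t^q m(B) <= J, and M^q = 2^q t^q. *)
set t := M / 2 in h.
have tp : 0 < t by rewrite /t; lra.
have {}h : t * fine (m B) <= t `^ (1 - q) * fine J.
  by move: h; rewrite (_ : M = t + t) ?mulrDl; [lra|rewrite /t; lra].
have -> : M `^ q = 2 `^ q * t `^ q.
  by rewrite -powRM ?(ltW tp)// /t mulrC divfK.
clearbody t.
have e1 : t `^ (q - 1) * t = t `^ q.
  by rewrite mulrC mulr_powRB1 ?ltW//; lra.
have e2 : t `^ (q - 1) * t `^ (1 - q) = 1.
  rewrite -powRD; last by rewrite (gt_eqF tp) implybT.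
  by rewrite (_ : q - 1 + (1 - q) = 0) ?powRr0//; lra.
have := ler_wpM2l (powR_ge0 t (q - 1)) h; rewrite !mulrA e1 e2 mul1r => key.
by rewrite -mulrA ler_wpM2l ?powR_ge0.
Qed.

(** With g = f - f' - c, the function f - avg f splits as (f' - avg f') + (g - avg g), in which c
    cancels. Two uses of [powRD_le] separate the three terms, and [powR_avg_le] absorbs the one with
    avg g. The last constant collects 5^3 * 2 from |g|^q and 5^3 * 5^3 * 2^q, with 2^q <= 2^3, from
    avg g. *)
Lemma integral_powR_sub_avg_le (q : R) (f f' : T -> R) (c : R) : 1 <= q <= 3 ->
  m.-integrable B (EFin \o f) -> m.-integrable B (EFin \o f') ->
  (\int[m]_(y in B) (`|f y - avg f| `^ q)%:E <=
   2%:E * \int[m]_(y in B) (`|f' y - avg f'| `^ q)%:E +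
   (5 ^+ 3 * 2 + 5 ^+ 3 * 5 ^+ 3 * 2 ^+ 3)%:E *
     \int[m]_(y in B) (`|f y - f' y - c| `^ q)%:E)%E.
Proof.
move=> /andP[q1 q3] fi f'i.
have q03 : 0 <= q <= 3 by apply/andP; split; lra.
have := fun a b => @powRD_le R q a b q03.
have : 0 <= 5 ^+ 3 :> R by rewrite exprn_ge0.
(* From here on only nonnegativity of the constant and the inequality for it are used, so the
   numeral is made opaque. *)
move: (5 ^+ 3) => c3 c30 powRD_c3.
have mint h : m.-integrable B (EFin \o h) -> measurable_fun B (h : T -> R).
  by move=> hi; apply/measurable_EFinP; exact: measurable_int hi.
have mf := mint _ fi; have mf' := mint _ f'i.
pose g y := f y - f' y - c.
have ffi : m.-integrable B (EFin \o (fun y => f y - f' y)).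
  by rewrite (_ : _ \o _ = (EFin \o f) \- (EFin \o f'))%E//; exact: integrableB.
have gi : m.-integrable B (EFin \o g).
  rewrite (_ : _ \o _ = (EFin \o (fun y => f y - f' y)%R) \- (EFin \o cst c))%E//.
  apply: integrableB => //; exact: finite_set_integrable_cst.
have mg := mint _ gi.
have int0 (h : T -> R) : (0 <= \int[m]_(y in B) (`|h y| `^ q)%:E)%E.
  by apply: integral_ge0 => y _; rewrite lee_fin powR_ge0.
(* On a null set the inverse in [avg] defaults to 0 and averaging does not preserve constants, so c
   would not cancel; there the left-hand integral is simply 0. *)
have [B0|B0] := eqVneq (m B) 0%E.
  rewrite [leLHS](null_set_integral mB _ B0).
  by rewrite adde_ge0 ?mule_ge0 ?lee_fin ?addr_ge0 ?mulr_ge0 ?exprn_ge0.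
  apply/measurable_EFinP/measurable_fun_normr_powR; exact: measurable_funB.
have avgg : avg g = avg f - avg f' - c.
  rewrite avgB//; last exact: finite_set_integrable_cst.
  by rewrite avgB// avg_cst.
have pt y : `|f y - avg f| `^ q <=
    2 * `|f' y - avg f'| `^ q + (c3 * 2 * `|g y| `^ q + c3 * c3 * `|avg g| `^ q).
  apply: (@le_trans _ _ ((`|f' y - avg f'| + (`|g y| + `|avg g|)) `^ q)).
    apply: ge0_ler_powR; rewrite ?nnegrE ?addr_ge0//; first lra.
    have -> : f y - avg f = (f' y - avg f') + (g y - avg g).
      by rewrite avgg /g; lra.
    by rewrite (le_trans (ler_normD _ _))// lerD2l ler_normB.
  have h1 := powRD_c3 _ _ (normr_ge0 (f' y - avg f'))
    (addr_ge0 (normr_ge0 (g y)) (normr_ge0 (avg g))).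
  have h2 := powRD_c3 _ _ (normr_ge0 (g y)) (normr_ge0 (avg g)).
  have := ler_wpM2l c30 h2; lra.
pose h y := c3 * 2 * `|g y| `^ q + c3 * c3 * `|avg g| `^ q.
have h0 y : 0 <= h y by rewrite addr_ge0// mulr_ge0 ?powR_ge0 ?mulr_ge0.
have mgq := measurable_fun_normr_powR q mg.
have mh : measurable_fun B h.
  by apply: measurable_funD => //; exact: measurable_funM.
apply: (@le_trans _ _ (2%:E * \int[m]_(y in B) (`|f' y - avg f'| `^ q)%:E +
   1%:E * \int[m]_(y in B) (h y)%:E)%E).
  have := (@integral_le_lincomb _ _ _ m _ 2 1 (fun y => `|f y - avg f| `^ q)
    (fun y => `|f' y - avg f'| `^ q) h mB).
  apply => //.
  - by apply: measurable_fun_normr_powR; exact: measurable_funB.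
  - by apply: measurable_fun_normr_powR; exact: measurable_funB.
  - by move=> y; rewrite mul1r; exact: pt.
rewrite mul1e leeD2l//.
apply: (@le_trans _ _ ((c3 * 2)%:E * \int[m]_(y in B) (`|g y| `^ q)%:E +
   (c3 * c3 * `|avg g| `^ q)%:E * \int[m]_(y in B) 1%:E)%E).
  have := @integral_le_lincomb _ _ _ m _ (c3 * 2) (c3 * c3 * `|avg g| `^ q) h
    (fun y => `|g y| `^ q) (cst 1) mB.
  apply => //.
  - by rewrite mulr_ge0.
  - by rewrite mulr_ge0 ?mulr_ge0 ?powR_ge0.
  - by move=> y; rewrite mulr1.
rewrite integral_cst// mul1e.
have := powR_avg_le q1 gi; set J := (\int[m]_(y in B) (`|g y| `^ q)%:E)%E.
move=> hJ.
have J0 : (0 <= J)%E by exact: int0.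
have h2 : ((2 `^ q)%:E * J <= (2 ^+ 3)%:E * J)%E.
  rewrite lee_wpmul2r// lee_fin.
  by rewrite -(@powR_mulrn _ 2 3)// ler_powR//; lra.
rewrite [(_ * `|avg g| `^ q)%:E]EFinM -muleA.
have h3 := lee_wpmul2l (_ : (0 <= (c3 * c3)%:E :> \bar R)%E) (le_trans hJ h2).
apply: (@le_trans _ _ ((c3 * 2)%:E * J + (c3 * c3)%:E * ((2 ^+ 3)%:E * J))%E).
  by rewrite leeD2l ?h3 ?lee_fin ?mulr_ge0.
by rewrite muleA -EFinM -ge0_muleDl ?lee_fin ?mulr_ge0 ?exprn_ge0.
Qed.

End average.

(** * Time slices of a product set and Fubini arguments *)

Section slices.
Context d1 d2 (T1 : measurableType d1) (T2 : measurableType d2) (R : realType).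
Variables (m1 : {sigma_finite_measure set T1 -> \bar R}).
Variables (m2 : {sigma_finite_measure set T2 -> \bar R}).
Variables (B : set T1) (I : set T2).
Hypotheses (mB : measurable B) (mI : measurable I) (mBoo : (m1 B < +oo)%E).

Let mBI : measurable (B `*` I). Proof. exact: measurableX. Qed.

(** Fubini and Tonelli are applied on the whole product, to the extension of [f] by zero; this
    translates its slices back to [B]. *)
Lemma patch_slice (f : T1 * T2 -> \bar R) s : I s ->
  (fun y => (f \_ (B `*` I)) (y, s)) = (fun y => f (y, s)) \_ B.
Proof.
move=> Is; apply/funext => y; rewrite /patch.
by congr (if _ then _ else _); rewrite in_setX/= (mem_set Is) andbT.
Qed.

Lemma integral_slice_patch (f : T1 * T2 -> \bar R) s : I s ->
  (\int[m1]_y (f \_ (B `*` I)) (y, s) = \int[m1]_(y in B) f (y, s))%E.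
Proof. by move=> Is; rewrite [RHS]integral_mkcond -patch_slice. Qed.

Lemma measurable_slice_integral (f : T1 * T2 -> \bar R) :
  measurable_fun (B `*` I) f -> (forall z, 0 <= f z)%E ->
  measurable_fun I (fun s => \int[m1]_(y in B) f (y, s))%E.
Proof.
move=> mf f0.
have mfT : measurable_fun setT (f \_ (B `*` I)).
  by exact/(measurable_restrictT _ mBI).
have fT0 z : (0 <= (f \_ (B `*` I)) z)%E by apply: erestrict_ge0 => ? _.
have := measurable_fun_fubini_tonelli_G (m1 := m1) _ mfT fT0.
move=> /(measurable_funS measurableT (@subsetT _ I)).
apply: eq_measurable_fun => s; rewrite inE => Is.
by rewrite /fubini_G integral_slice_patch.
Qed.

Lemma tonelli_slice (f : T1 * T2 -> \bar R) :
  measurable_fun (B `*` I) f -> (forall z, 0 <= f z)%E ->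
  (\int[m1 \x m2]_(z in B `*` I) f z =
   \int[m2]_(s in I) \int[m1]_(y in B) f (y, s))%E.
Proof.
move=> mf f0; rewrite integral_mkcond fubini_tonelli2;
  [|exact/(measurable_restrictT _ mBI)|]; last first.
  by move=> z; apply: erestrict_ge0 => ? _.
rewrite [RHS]integral_mkcond; apply: eq_integral => s _.
rewrite /fubini_G [RHS]patchE; have [Is|nIs] := pselect (I s).
  by rewrite (mem_set Is) integral_slice_patch.
(* For times outside [I] the slice of the zero extension vanishes identically. *)
rewrite (memNset nIs) integral0_eq// => y _; rewrite patchE ifF//.
by apply/negP; rewrite inE/= => -[].
Qed.

Lemma ae_integrable_slice (f : T1 * T2 -> R) :
  (m1 \x m2)%E.-integrable (B `*` I) (EFin \o f) ->
  {ae m2, forall s, I s -> m1.-integrable B (EFin \o (fun y => f (y, s)))}.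
Proof.
move=> /(integrable_mkcond _ mBI) /ae_integrable2.
apply: filterS => s fs Is.
by apply/(integrable_mkcond _ mB); rewrite -(patch_slice (EFin \o f) Is).
Qed.

(** Up to a constant factor the average is [fine] of the extended-real slice integral, at every time
    in [I], so the exceptional times with default values do not spoil measurability. *)
Lemma measurable_avg_slice (f : T1 * T2 -> R) :
  (m1 \x m2)%E.-integrable (B `*` I) (EFin \o f) ->
  measurable_fun I (fun s => avg m1 B (fun y => f (y, s))).
Proof.
move=> /(integrable_mkcond _ mBI) /measurable_fubini_G.
move=> /(measurable_funS measurableT (@subsetT _ I)) mG.
apply: measurable_funM => //.
apply: (@eq_measurable_fun _ _ _ _ _ (fine \o
  (fun s => \int[m1]_y ((EFin \o f) \_ (B `*` I)) (y, s))%E)).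
  by move=> s; rewrite inE => Is; rewrite /= integral_slice_patch.
exact: measurableT_comp.
Qed.

(** At a fixed time [s] the number [a s] is a constant, so [integral_powR_sub_avg_le] applies with
    [c := a s] on almost every slice. Integrating in time and using Tonelli on the last term gives
    the claim. *)
Lemma integral_slices_sub_avg_le (q : R) (f f' : T1 * T2 -> R) (a : T2 -> R) :
  1 <= q <= 3 ->
  (m1 \x m2)%E.-integrable (B `*` I) (EFin \o f) ->
  (m1 \x m2)%E.-integrable (B `*` I) (EFin \o f') ->
  measurable_fun I a ->
  (\int[m2]_(s in I) \int[m1]_(y in B)
     (`|f (y, s) - avg m1 B (fun y => f (y, s))| `^ q)%:E <=
   2%:E * \int[m2]_(s in I) \int[m1]_(y in B)
     (`|f' (y, s) - avg m1 B (fun y => f' (y, s))| `^ q)%:E +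
   (5 ^+ 3 * 2 + 5 ^+ 3 * 5 ^+ 3 * 2 ^+ 3)%:E *
     \int[m1 \x m2]_(z in B `*` I) (`|f z - f' z - a z.2| `^ q)%:E)%E.
Proof.
move=> q13 fi f'i ma.
have mtime (c : T2 -> R) : measurable_fun I c ->
    measurable_fun (B `*` I) (fun z => c z.2).
  move=> mc; apply: (measurable_comp mI) => //; first by move=> _ [[y s] [_ ?] <-].
  exact: measurable_funTS.
have mint h : (m1 \x m2)%E.-integrable (B `*` I) (EFin \o h) ->
    measurable_fun (B `*` I) h.
  by move=> hi; apply/measurable_EFinP; exact: measurable_int hi.
have mavg h : (m1 \x m2)%E.-integrable (B `*` I) (EFin \o h) ->
    measurable_fun (B `*` I)
      (fun z => (`|h z - avg m1 B (fun y => h (y, z.2))| `^ q)%:E).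
  move=> hi; apply/measurable_EFinP/measurable_fun_normr_powR/measurable_funB.
    exact: mint.
  by apply: (mtime (fun s => avg m1 B (fun y => h (y, s))));
    exact: measurable_avg_slice.
have mg : measurable_fun (B `*` I) (fun z => (`|f z - f' z - a z.2| `^ q)%:E).
  apply/measurable_EFinP/measurable_fun_normr_powR/measurable_funB.
    by apply: measurable_funB; exact: mint.
  exact: mtime.
rewrite tonelli_slice//.
have := @ae_integral_le_lincomb _ _ _ m2 _ 2 (5 ^+ 3 * 2 + 5 ^+ 3 * 5 ^+ 3 * 2 ^+ 3)
  (fun s => \int[m1]_(y in B) (`|f (y, s) - avg m1 B (fun y => f (y, s))| `^ q)%:E)%E
  (fun s => \int[m1]_(y in B) (`|f' (y, s) - avg m1 B (fun y => f' (y, s))| `^ q)%:E)%E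
  (fun s => \int[m1]_(y in B) (`|f (y, s) - f' (y, s) - a s| `^ q)%:E)%E mI.
apply.
- by [].
- by rewrite addr_ge0 ?mulr_ge0 ?exprn_ge0.
- exact: (measurable_slice_integral (mavg _ fi)).
- exact: (measurable_slice_integral (mavg _ f'i)).
- exact: (measurable_slice_integral mg).
- by move=> s _; apply: integral_ge0 => y _; rewrite lee_fin powR_ge0.
- by move=> s _; apply: integral_ge0 => y _; rewrite lee_fin powR_ge0.
- by move=> s _; apply: integral_ge0 => y _; rewrite lee_fin powR_ge0.
- move: (ae_integrable_slice fi) (ae_integrable_slice f'i).
  apply: filterS2 => s fs f's Is.
  by apply: integral_powR_sub_avg_le => //; [exact: fs|exact: f's].
Qed.

End slices.

(** * Norms on a set as integrals *)

Lemma powR_LnormOn (R : realType) (q : R) (D : set (spacetime R))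
    (f : spacetime R -> R) : 0 < q ->
  (LnormOn q D f `^ q = \int[leb4 R]_(z in D) (`|f z| `^ q)%:E)%E.
Proof.
move=> q0; have qn0 : q != 0 by rewrite gt_eqF.
(* Both sides become integrals over the whole space; off [D] the left integrand is 0 to the power
   [q], which is 0 since [q] is nonzero. *)
rewrite /LnormOn (powR_Lnorm _ _ qn0) [RHS]integral_mkcond.
apply: eq_integral => z _; rewrite patchE [_ z]/= patchE.
case: (z \in D); first by [].
by rewrite /= normr0 powR0.
Qed.

Lemma integral_le_LnormOn (R : realType) (q t : R) (D : set (spacetime R))
    (f : spacetime R -> R) : 0 < q -> (LnormOn q D f <= t%:E)%E ->
  (\int[leb4 R]_(z in D) (`|f z| `^ q)%:E <= (t `^ q)%:E)%E.
Proof.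
move=> q0 ft; rewrite -powR_LnormOn// -poweR_EFin.
have f0 : (0 <= LnormOn q D f)%E by exact: Lnorm_ge0.
by apply: gt0_ler_poweR; rewrite ?in_itv/= ?leey ?andbT ?f0 ?(le_trans f0)// ltW.
Qed.

(** * The Euclidean norm, balls and cylinders *)

Section geometry.
Variable R : realType.

Lemma enorm_ge0 (x : Defs.space R) : 0 <= enorm x. Proof. exact: sqrtr_ge0. Qed.

Lemma ler_enormD (x y : Defs.space R) : enorm (x + y) <= enorm x + enorm y.
Proof.
case: x y => -[a b] c [[a' b'] c']; rewrite /enorm /=.
set A := a ^+ 2 + b ^+ 2 + c ^+ 2; set A' := a' ^+ 2 + b' ^+ 2 + c' ^+ 2.
have A0 : 0 <= A by rewrite !addr_ge0// sqr_ge0.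
have A'0 : 0 <= A' by rewrite !addr_ge0// sqr_ge0.
have cs : a * a' + b * b' + c * c' <= Num.sqrt A * Num.sqrt A'.
  rewrite -sqrtrM//; apply: (le_trans (ler_norm _)).
  rewrite -sqrtr_sqr ler_sqrt ?mulr_ge0//.
  (* Lagrange's identity: the Cauchy-Schwarz defect is the squared length of the cross product. *)
  rewrite -subr_ge0 (_ : _ - _ = (a * b' - b * a') ^+ 2 + (a * c' - c * a') ^+ 2
    + (b * c' - c * b') ^+ 2); last by rewrite /A /A'; ring.
  by rewrite !addr_ge0// sqr_ge0.
rewrite -[leRHS]ger0_norm ?addr_ge0 ?sqrtr_ge0// -sqrtr_sqr ler_sqrt ?sqr_ge0//.
rewrite [leRHS]sqrrD !sqr_sqrtr//.
rewrite [leLHS](_ : _ = A + (a * a' + b * b' + c * c') *+ 2 + A'); last first.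
  by rewrite /A /A'; ring.
by rewrite lerD2r lerD2l lerMn2r cs orbT.
Qed.

Lemma enorm_le_sub (x y : Defs.space R) : enorm x <= enorm y + enorm (x - y).
Proof. by rewrite -{1}(subrK y x) addrC ler_enormD. Qed.

(** Stated through components so that it also covers the difference of two fields, whose components
    are handled one by one. *)
Lemma measurable_enorm_comp d (T : measurableType d) (D : set T)
    (f : T -> Defs.space R) :
  measurable_fun D (fun x => (f x).1.1) ->
  measurable_fun D (fun x => (f x).1.2) ->
  measurable_fun D (fun x => (f x).2) ->
  measurable_fun D (fun x => enorm (f x)).
Proof.
move=> m1 m2 m3; apply: (@measurableT_comp _ _ _ _ _ _ (@Num.sqrt R)).
  by apply: continuous_measurable_fun; exact: sqrt_continuous.
apply: measurable_funD; first apply: measurable_funD.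
- exact: (@measurable_funX _ _ _ _ (fun x => (f x).1.1 : R)).
- exact: (@measurable_funX _ _ _ _ (fun x => (f x).1.2 : R)).
- exact: (@measurable_funX _ _ _ _ (fun x => (f x).2 : R)).
Qed.

Section components.
Context d (T : measurableType d) (D : set T) (f : T -> Defs.space R).
Hypothesis mf : measurable_fun D f.

Lemma measurable_component1 : measurable_fun D (fun x => (f x).1.1).
Proof.
have m1 : measurable_fun D (fst \o f) by apply: measurableT_comp.
exact: (@measurableT_comp _ _ _ _ _ _ fst _ (fst \o f)).
Qed.

Lemma measurable_component2 : measurable_fun D (fun x => (f x).1.2).
Proof.
have m1 : measurable_fun D (fst \o f) by apply: measurableT_comp.
exact: (@measurableT_comp _ _ _ _ _ _ snd _ (fst \o f)).
Qed.

Lemma measurable_component3 : measurable_fun D (fun x => (f x).2).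
Proof. exact: (@measurableT_comp _ _ _ _ _ _ snd _ f). Qed.

End components.

Lemma measurable_enorm d (T : measurableType d) (D : set T)
    (f : T -> Defs.space R) :
  measurable_fun D f -> measurable_fun D (fun x => enorm (f x)).
Proof.
move=> mf; apply: measurable_enorm_comp.
- exact: measurable_component1.
- exact: measurable_component2.
- exact: measurable_component3.
Qed.

Lemma measurable_enormB d (T : measurableType d) (D : set T)
    (f g : T -> Defs.space R) :
  measurable_fun D f -> measurable_fun D g ->
  measurable_fun D (fun x => enorm (f x - g x)).
Proof.
move=> mf mg; apply: (measurable_enorm_comp (f := fun x => f x - g x)).
- exact: (measurable_funB (measurable_component1 mf) (measurable_component1 mg)).
- exact: (measurable_funB (measurable_component2 mf) (measurable_component2 mg)).
- exact: (measurable_funB (measurable_component3 mf) (measurable_component3 mg)).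
Qed.

Lemma measurable_Ball (r : R) : measurable (Ball r).
Proof.
have := @measurable_enorm _ _ setT (@id (Defs.space R)) (@measurable_id _ _ _).
move=> /(_ measurableT _ (measurable_itv `]-oo, r[)).
by rewrite setTI.
Qed.

Lemma measurable_Itime (r : R) : measurable (Itime r).
Proof. exact: measurable_itv. Qed.

Lemma measurable_Cyl (r : R) : measurable (Cyl r).
Proof. by apply: measurableX; [exact: measurable_Ball|exact: measurable_Itime]. Qed.

Lemma lebesgue_itvoo_lty (a b : R) : (@lebesgue_measure R `]a, b[%classic < +oo)%E.
Proof. by rewrite lebesgue_measure_itv/=; case: ifP => _; rewrite ltry. Qed.

(** The ball lies in the cube of side 2r, whose product measure is a product of three finite
    lengths. *)
Lemma leb3_Ball_lty (r : R) : (leb3 R (Ball r) < +oo)%E.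
Proof.
pose J : set (time R) := `]- r, r[%classic.
have mJ : measurable J by exact: measurable_itv.
have sub : Ball r `<=` J `*` J `*` J.
  move=> -[[a b] c]; rewrite /Ball /= /enorm /= => abc.
  (* Proved for the first variable only; the other coordinates follow by permuting the sum of
     squares. *)
  have coord (x y z : R) : Num.sqrt (x ^+ 2 + y ^+ 2 + z ^+ 2) < r -> J x.
    move=> /(le_lt_trans _) h; rewrite /J /= in_itv/= -ltr_norml h//.
    rewrite -sqrtr_sqr ler_sqrt ?addr_ge0 ?sqr_ge0//.
    by rewrite -addrA lerDl addr_ge0// sqr_ge0.
  split; [split|] => /=.
  - exact: coord abc.
  - by apply: (coord b a c); rewrite (addrC (b ^+ 2)).
  - by apply: (coord c a b); rewrite -addrA addrC.
apply: (@le_lt_trans _ _ (leb3 R (J `*` J `*` J))).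
  apply: le_measure => //; rewrite inE; first exact: measurable_Ball.
  by apply: measurableX => //; exact: measurableX.
have E3 : leb3 R (J `*` J `*` J) = ((@lebesgue_measure R \x @lebesgue_measure R)
    (J `*` J) * @lebesgue_measure R J)%E.
  by apply: product_measure1E => //; exact: measurableX.
rewrite E3 product_measure1E//.
have JE : (@lebesgue_measure R J < +oo)%E by exact: lebesgue_itvoo_lty.
by rewrite !lte_mul_pinfty// ?mule_ge0// ge0_fin_numE// ?mule_ge0
   ?lte_mul_pinfty ?ge0_fin_numE.
Qed.

Lemma leb3_sigma_finite : sigma_finite [set: Defs.space R] (leb3 R).
Proof.
(* Balls of integer radius exhaust the space by the Archimedean property. *)
exists (fun n => Ball (n%:R : R)).
  apply/seteqP; split=> // x _; exists (Num.bound (enorm x)) => //.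
  by rewrite /Ball/= archi_boundP// sqrtr_ge0.
by move=> n; split; [exact: measurable_Ball|exact: leb3_Ball_lty].
Qed.

Lemma leb4_Cyl_lty (r : R) : (leb4 R (Cyl r) < +oo)%E.
Proof.
have -> : leb4 R (Cyl r) = (leb3 R (Ball r) * @lebesgue_measure R (Itime r))%E.
  by apply: product_measure1E; [exact: measurable_Ball|exact: measurable_Itime].
rewrite lte_mul_pinfty ?leb3_Ball_lty//; last exact: lebesgue_itvoo_lty.
by rewrite ge0_fin_numE ?leb3_Ball_lty.
Qed.

Lemma subset_Cyl (r s : R) : 0 <= r -> r <= s -> Cyl r `<=` Cyl s.
Proof.
move=> r0 rs -[y t] [/= yr]; rewrite /Itime /= !in_itv/= => /andP[rt t0].
split; first exact: lt_le_trans yr rs.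
rewrite /Itime /= in_itv/= t0 andbT (le_lt_trans _ rt)// lerN2.
by apply: lerXn2r; rewrite ?nnegrE// (le_trans r0).
Qed.

End geometry.


(** * Stability of [Phi] under small perturbations of the fields *)

Lemma pre_integrable (R : realType) (w : nfields R) (r : R) : 0 <= r -> r <= 1 ->
  (leb4 R).-integrable (Cyl r) (EFin \o pre w).
Proof.
move=> r0 r1; apply: (integrableS (measurable_Cyl 1) (measurable_Cyl r)).
  exact: subset_Cyl.
have mp : measurable_fun (Cyl 1) (pre w) by exact: pre_meas.
have mpq : measurable_fun (Cyl 1) (fun z => `|pre w z| `^ (3 / 2)).
  exact: measurable_fun_normr_powR.
apply/integrableP; split; first exact/measurable_EFinP.
(* Pointwise |p| <= 1 + |p|^(3/2), and the cylinder has finite measure. *)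
have bound : (\int[leb4 R]_(z in Cyl 1) (`|pre w z|)%:E <=
    1%:E * \int[leb4 R]_(z in Cyl 1) (cst 1 z)%:E +
    1%:E * \int[leb4 R]_(z in Cyl 1) (`|pre w z| `^ (3 / 2))%:E)%E.
  have := @integral_le_lincomb _ _ _ (leb4 R) (Cyl 1) 1 1 (fun z => `|pre w z|)
    (cst 1) (fun z => `|pre w z| `^ (3 / 2)) (measurable_Cyl 1).
  apply => //.
  - exact: measurableT_comp.
  - move=> z; rewrite !mul1r; have [h|h] := leP `|pre w z| 1.
      by rewrite (le_trans h)// lerDl powR_ge0.
    by apply: ler_wpDl => //; apply: le1r_powR; [exact: ltW|lra].
apply: (le_lt_trans bound); rewrite !mul1e lte_add_pinfty//.
  by rewrite (integral_cst (leb4 R) (measurable_Cyl 1) 1%E) mul1e leb4_Cyl_lty.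
rewrite -powR_LnormOn; last lra.
apply: poweR_lty; exact: pre_L32.
Qed.

Section Phi_stability.
Variables (R : realType) (r : R).
Hypotheses (r0 : 0 <= r) (r1 : r <= 1).

Lemma vel_measS (w : nfields R) : measurable_fun (Cyl r) (vel w).
Proof.
apply: (measurable_funS (measurable_Cyl 1)); last exact: vel_meas.
exact: subset_Cyl.
Qed.

(** Pointwise triangle inequality followed by [powRD_le] with q = 3. The last integrand is written
    with an absolute value and a real power to match [powR_LnormOn]. *)
Lemma velocity_Phi_le (w w' : nfields R) :
  (\int[leb4 R]_(z in Cyl r) (enorm (vel w z) ^+ 3)%:E <=
   2%:E * \int[leb4 R]_(z in Cyl r) (enorm (vel w' z) ^+ 3)%:E +
   (5 ^+ 3)%:E *
     \int[leb4 R]_(z in Cyl r) (`|enorm (vel w z - vel w' z)%R| `^ 3)%:E)%E.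
Proof.
have := @integral_le_lincomb _ _ _ (leb4 R) (Cyl r) 2 (5 ^+ 3)
  (fun z => enorm (vel w z) ^+ 3) (fun z => enorm (vel w' z) ^+ 3)
  (fun z => `|enorm (vel w z - vel w' z)| `^ 3) (measurable_Cyl r).
apply.
- by [].
- exact: exprn_ge0.
- by apply: measurable_funX; apply: measurable_enorm; exact: vel_measS.
- by apply: measurable_funX; apply: measurable_enorm; exact: vel_measS.
- apply: measurable_fun_normr_powR.
  by apply: measurable_enormB; exact: vel_measS.
- by move=> z; rewrite exprn_ge0 ?enorm_ge0.
- by move=> z; rewrite exprn_ge0 ?enorm_ge0.
- by move=> z; rewrite powR_ge0.
move=> z; rewrite (ger0_norm (enorm_ge0 _)).
rewrite -(powR_mulrn 3 (enorm_ge0 (vel w z))).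
rewrite -(powR_mulrn 3 (enorm_ge0 (vel w' z))).
apply: (@le_trans _ _ ((enorm (vel w' z) + enorm (vel w z - vel w' z)) `^ 3)).
  by apply: ge0_ler_powR; rewrite ?nnegrE ?addr_ge0 ?enorm_ge0 ?enorm_le_sub.
by apply: powRD_le; rewrite ?enorm_ge0// lexx andbT.
Qed.

Lemma pressure_Phi_le (w w' : nfields R) (a : time R -> R) :
  measurable_fun (Itime r) a ->
  (\int[@lebesgue_measure R]_(s in Itime r) \int[leb3 R]_(y in Ball r)
     (`|pre w (y, s) - mean (pre w) r s| `^ (3 / 2))%:E <=
   2%:E * \int[@lebesgue_measure R]_(s in Itime r) \int[leb3 R]_(y in Ball r)
     (`|pre w' (y, s) - mean (pre w') r s| `^ (3 / 2))%:E +
   (5 ^+ 3 * 2 + 5 ^+ 3 * 5 ^+ 3 * 2 ^+ 3)%:E *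
     \int[leb4 R]_(z in Cyl r)
       (`|(pre w z - pre w' z - a z.2)%R| `^ (3 / 2))%:E)%E.
Proof.
move=> ma.
(* [leb3 R] is only declared as a measure; Fubini needs sigma-finiteness. *)
pose m3 : {sigma_finite_measure set (Defs.space R) -> \bar R} :=
  HB.pack (Measure.sort (leb3 R))
    (Measure_isSigmaFinite.Build _ _ _ (leb3 R) (leb3_sigma_finite R)).
have B3oo : (m3 (Ball r) < +oo)%E by exact: leb3_Ball_lty.
have q13 : 1 <= (3 / 2 : R) <= 3 by apply/andP; split; lra.
exact: (@integral_slices_sub_avg_le _ _ _ _ _ m3 (@lebesgue_measure R) _ _
  (measurable_Ball r) (measurable_Itime r) B3oo (3 / 2) (pre w) (pre w') a q13
  (pre_integrable w r0 r1) (pre_integrable w' r0 r1) ma).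
Qed.

End Phi_stability.

(** [K] is chosen before the fields, which makes the final threshold uniform in the package. The
    restriction t <= 1 bounds both t^3 and t^(3/2) by t, so the error is linear. *)
Lemma Phi_close_le (R : realType) (r : R) : 0 <= r <= 1 ->
  exists2 K : R, 0 < K & forall (w w' : nfields R) (t : R), 0 <= t <= 1 ->
    (LnormOn 3 (Cyl r) (fun z => enorm (vel w z - vel w' z)%R) +
       pdist r w w' < t%:E)%E ->
    (Phi w r <= 2%:E * Phi w' r + (K * t)%:E)%E.
Proof.
move=> /andP[r0 r1].
pose K1 : R := 5 ^+ 3; pose K2 : R := 5 ^+ 3 * 2 + 5 ^+ 3 * 5 ^+ 3 * 2 ^+ 3.
have K10 : 0 < K1 by rewrite exprn_gt0.
have K20 : 0 < K2 by rewrite addr_gt0 ?mulr_gt0 ?exprn_gt0.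
exists (K1 + K2); first exact: addr_gt0.
move=> w w' t /andP[t0 t1] dt.
have N0 : (0 <= LnormOn 3 (Cyl r) (fun z => enorm (vel w z - vel w' z)%R))%E.
  exact: Lnorm_ge0.
have P0 : (0 <= pdist r w w')%E.
  by apply/ereal_infP => _ [a _ <-]; exact: Lnorm_ge0.
have Nt : (LnormOn 3 (Cyl r) (fun z => enorm (vel w z - vel w' z)%R) <= t%:E)%E.
  by apply: (le_trans _ (ltW dt)); rewrite leeDl.
(* The strict bound yields an actual function of time, without the infimum having to be attained. *)
have /ereal_inf_lt[_ [a ma <-] /ltW at_] : (pdist r w w' < t%:E)%E.
  by apply: (le_lt_trans _ dt); rewrite leeDr.
have powt q : 1 <= q -> t `^ q <= t.
  move=> q1; have [->|tn0] := eqVneq t 0.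
    by rewrite powR0// gt_eqF//; lra.
  by apply: ge1r_powR => //; rewrite lt0r tn0 t0.
have hv : (\int[leb4 R]_(z in Cyl r)
    (`|enorm (vel w z - vel w' z)%R| `^ 3)%:E <= t%:E)%E.
  apply: (le_trans (integral_le_LnormOn _ Nt)) => //.
  by rewrite lee_fin powt// ler1n.
have hp : (\int[leb4 R]_(z in Cyl r)
    (`|(pre w z - pre w' z - a z.2)%R| `^ (3 / 2))%:E <= t%:E)%E.
  apply: (le_trans (integral_le_LnormOn _ at_)); first lra.
  by rewrite lee_fin powt//; lra.
have hV := velocity_Phi_le r0 r1 w w'; have hP := pressure_Phi_le r0 r1 w w' ma.
rewrite /Phi ge0_muleDr; last 2 first.
- by apply: integral_ge0 => z _; rewrite lee_fin exprn_ge0 ?enorm_ge0.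
- apply: integral_ge0 => s _; apply: integral_ge0 => y _.
  by rewrite lee_fin powR_ge0.
apply: (le_trans (leeD hV hP)).
have -> : ((K1 + K2) * t)%:E = (K1%:E * t%:E + K2%:E * t%:E)%E.
  by rewrite mulrDl EFinD !EFinM.
rewrite addeACA leeD2l//.
have K1E0 : (0 <= K1%:E)%E by rewrite lee_fin ltW.
have K2E0 : (0 <= K2%:E)%E by rewrite lee_fin ltW.
exact: (leeD (lee_wpmul2l K1E0 hv) (lee_wpmul2l K2E0 hp)).
Qed.

(** * The distance gap for packages with large [Phi] *)

Theorem corollary16p13 (R : realType) (theta epsCKN : R)
    (theta_gt0 : 0 < theta) (theta_lt1 : theta < 1) (eps_gt0 : 0 < epsCKN) :
  exists tauCKN : R, 0 < tauCKN /\
  forall (package : nat -> Type) (fields : forall k, package k -> nfields R)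
         (GammaCKN : R -> forall k, set (package k))
         (delta : forall k, package k -> R)
         (Deltagauge : nat -> R) (Caud : R)
         (Lambda : R) (k : nat) (D : package k),
    (forall zeta, GammaCKN Lambda k zeta ->
       (Phi (fields k zeta) theta <= (epsCKN / 4)%:E)%E) ->
    0 <= delta k D -> 0 <= Deltagauge k -> 0 < Caud ->
    (deltaCKN (fields k) theta (GammaCKN Lambda k) (fields k D)
       <= (Caud * delta k D + Deltagauge k)%:E)%E ->
    (epsCKN%:E <= Phi (fields k D) theta)%E ->
    tauCKN < Caud * delta k D + Deltagauge k /\
    (Deltagauge k <= tauCKN / 2 -> tauCKN / (2 * Caud) <= delta k D).
Proof.
have theta01 : 0 <= theta <= 1 by rewrite !ltW.
have [K K0 Phi_close] := Phi_close_le theta01.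
(* Chosen so that K t <= eps/4: a clean competitor within [t] would give Phi <= 2 * eps/4 + eps/4 <
   eps. *)
pose t := Num.min 1 (epsCKN / (4 * K)).
have t0 : 0 < t by rewrite lt_min ltr01 divr_gt0// mulr_gt0.
have t1 : t <= 1 by rewrite ge_min lexx.
have Kt : K * t <= epsCKN / 4.
  have : t <= epsCKN / (4 * K) by rewrite ge_min lexx orbT.
  by rewrite invfM mulrA ler_pdivlMr// mulrC.
(* Halving leaves room for strictness: an audit bound at most [t / 2] makes the infimum strictly
   less than [t]. *)
exists (t / 2); split; first by rewrite divr_gt0.
move=> package fields GammaCKN delta Deltagauge Caud Lambda k D.
move=> clean d0 _ C0 dD PhiD.
have gap : t / 2 < Caud * delta k D + Deltagauge k.
  rewrite ltNge; apply/negP => small.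
  have : (deltaCKN (fields k) theta (GammaCKN Lambda k) (fields k D) < t%:E)%E.
    by apply: (le_lt_trans dD); rewrite lte_fin; lra.
  (* This also settles the empty class, whose infimum +oo is not below [t]. *)
  move=> /ereal_inf_lt[_ [zeta /clean zeta_clean <-] close].
  have := Phi_close _ _ t _ close; rewrite (ltW t0) t1 => /(_ isT) PhiD_le.
  have : (epsCKN%:E <= 2%:E * (epsCKN / 4)%:E + (K * t)%:E)%E.
    apply: (le_trans PhiD); apply: (le_trans PhiD_le).
    by rewrite leeD2r// lee_wpmul2l// lee_fin.
  by rewrite -EFinM -EFinD lee_fin; lra.
split=> // gauge_le.
(* Subtracting the gauge error from the gap leaves more than tau/2 for [Caud * delta k D]. *)
by rewrite ler_pdivrMr ?mulr_gt0//; lra.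
Qed.
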